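(* Let $\Omega\subset\mathbb{R}^2$ be open and connected, let $V=(P,Q)\in C^2(\Omega,\mathbb{R}^2)$, and let $\kappa$ be a reciprocal integrating factor of $V$ on $\Omega$. Then, on the open set where $V\neq 0$, the vector field $$W=\left(-\kappa\,\frac{Q}{P^2+Q^2},\ \kappa\,\frac{P}{P^2+Q^2}\right)$$ is a normalizer of $V$, and the function $\mu$ such that $[V,W]=\mu V$ is $$\mu=\kappa\ \frac{-P^2(Q_x+P_y)+2PQ(P_x-Q_y)+Q^2(Q_x+P_y)}{(P^2+Q^2)^2}.$$ Here, if $H$ is a first integral of $V$ corresponding to $\kappa$, i.e. $P=\kappa H_y$ and $Q=-\kappa H_x$ (so that $\kappa=|V|/|\nabla H|$ where $V\ne 0$), then $$W=\left(-\frac{Q}{|V|\,|\nabla H|},\ \frac{P}{|V|\,|\nabla H|}\right).$$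
   Context: A reciprocal integrating factor of a vector field $V=(P,Q)$ on $\Omega$ is a function $\kappa\in C^1(\Omega,\mathbb{R})$, $\kappa>0$, such that $1/\kappa$ is an integrating factor of $z'=V(z)$; equivalently, $\kappa_xP+\kappa_yQ=\kappa(P_x+Q_y)$, that is $\partial_V\kappa=\kappa\operatorname{div}V$. A first integral of $V$ on an open set $A$ is a function $H\in C^1(A,\mathbb{R})$ that is non-constant on every open subset of $A$ and is constant on $\gamma\cap A$ for every orbit $\gamma$ of $z'=V(z)$. For vector fields $V,U$, the Lie bracket is $[V,U]=\partial_V U-\partial_U V$, where $\partial_V U$ is the directional derivative of $U$ along $V$ (i.e. $(DU)V$). For planar vectors, $V\wedge U=V_1U_2-V_2U_1$. A vector field $U$ is a normalizer of $V$ on a set $A$ if $[V,U]\wedge V=0$ on $A$; where $V$ does not vanish this is equivalent to $[V,U]=\mu V$ with $\mu=\frac{[V,U]\cdot V}{|V|^2}$. *)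

(* Defs.v *)
(* The plane is R * R, for an arbitrary R : realType. *)
From mathcomp Require Import all_boot all_order all_algebra.
From mathcomp Require Import all_classical all_reals all_analysis.

Set Implicit Arguments.
Unset Strict Implicit.
Unset Printing Implicit Defensive.

Import Order.TTheory GRing.Theory Num.Theory.
Import numFieldNormedType.Exports.

Local Open Scope classical_set_scope.
Local Open Scope ring_scope.

Section Plane.
Context {R : realType}.

(* Functions and vector fields are total on the plane; only their values on the
   open set under consideration matter, since all notions below are local. *)
Implicit Types (A Omega : set (R * R)) (f H m kappa : R * R -> R).
Implicit Types (U V : R * R -> R * R) (z w : R * R).

Definition dx f z : R := 'D_((1, 0) : R * R) f z.
Definition dy f z : R := 'D_((0, 1) : R * R) f z.

(* C^n on the open set A; 'D is a total operator, hence the explicit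
   differentiability requirement. *)
Fixpoint Cn (n : nat) A f : Prop :=
  match n with
  | 0 => forall z, A z -> {for z, continuous f}
  | n'.+1 => [/\ forall z, A z -> differentiable f z,
                 Cn n' A (dx f) & Cn n' A (dy f)]
  end.

Definition CnV (n : nat) A U : Prop :=
  Cn n A (fun z => (U z).1) /\ Cn n A (fun z => (U z).2).

Definition divergence U z : R :=
  dx (fun w => (U w).1) z + dy (fun w => (U w).2) z.

Definition grad f z : R * R := (dx f z, dy f z).

(* The library norm on R * R is the sup norm. *)
Definition enorm (v : R * R) : R := Num.sqrt (v.1 ^+ 2 + v.2 ^+ 2).

Definition wedge (v u : R * R) : R := v.1 * u.2 - v.2 * u.1.

Definition lie_bracket V U z : R * R := 'D_(V z) U z - 'D_(U z) V z.

Definition normalizer A V U : Prop :=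
  CnV 1 A U /\ forall z, A z -> wedge (lie_bracket V U z) (V z) = 0.

(* m (P dy - Q dx) is closed, where V = (P, Q). *)
Definition integrating_factor A V m : Prop :=
  [/\ Cn 1 A m, forall z, A z -> m z != 0 &
      forall z, A z -> divergence (fun w => m w *: V w) z = 0].

Definition reciprocal_integrating_factor A V kappa : Prop :=
  [/\ Cn 1 A kappa, forall z, A z -> 0 < kappa z &
      integrating_factor A V (fun z => (kappa z)^-1)].

Definition solution Omega V (J : set R) (g : R -> R * R) : Prop :=
  [/\ open J, is_interval J, J !=set0 &
      forall t : R, J t -> Omega (g t) /\ is_derive t (1 : R) g (V (g t))].

Definition maximal_solution Omega V (J : set R) (g : R -> R * R) : Prop :=
  solution Omega V J g /\
  forall (J' : set R) (g' : R -> R * R), solution Omega V J' g' ->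
    J `<=` J' -> (forall t, J t -> g' t = g t) -> J' `<=` J.

Definition orbit Omega V (gamma : set (R * R)) : Prop :=
  exists (J : set R) (g : R -> R * R),
    maximal_solution Omega V J g /\ gamma = g @` J.

(* H is a first integral on A of the field V defined on Omega; the orbits are
   those of V on the whole of Omega, so their trace on A may be disconnected. *)
Definition first_integral Omega V A H : Prop :=
  [/\ Cn 1 A H,
      forall B : set (R * R), open B -> B `<=` A -> B !=set0 ->
        ~ (exists c : R, forall z, B z -> H z = c) &
      forall gamma, orbit Omega V gamma ->
        forall z w, (gamma `&` A) z -> (gamma `&` A) w -> H z = H w].

End Plane.

(* Main.v *)
Require Import Defs.
From mathcomp Require Import all_boot all_order all_algebra.
From mathcomp Require Import all_classical all_reals all_analysis.
From mathcomp Require Import ring.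
Import Order.TTheory GRing.Theory Num.Theory.
Import numFieldNormedType.Exports.
Local Open Scope classical_set_scope.
Local Open Scope ring_scope.

(** Write [N = P^2 + Q^2].  The field [W] is the rotation of [V] by a right
    angle, multiplied by [kappa / N].  Differentiating the quotients, the two
    parts of the bracket are

    - [D_V W], in which [kappa] enters only through its derivative along [V];
      since [kappa] is a reciprocal integrating factor, that derivative is
      [kappa * div V] (derive_reciprocal_integrating_factor);
    - [D_W V], which is the Jacobian matrix of [V] applied to [W].

    After this substitution [V, W] is a rational expression in [P], [Q], [kappa]
    and the four first partial derivatives of [P] and [Q].  The component
    transverse to [V] cancels, and what is left is the stated [mu] times [V]
    (lie_bracket_normalizer_field).  Hence [V, W] and [V] have zero wedge, and
    [mu] is unique because [V] does not vanish on [A].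

    A normalizer is also required to be of class C^1, so that one needs the
    closure of C^n functions on an open set under sums, products and inverses.
    A partial derivative of a product is known only at the points of the open
    set, so that these closure results rest on the fact that being C^n on an
    open set depends only on the values there (Cn_eq).

    For the last part, [V = kappa * (H_y, - H_x)] is [kappa] times the rotation
    of [grad H], so that [|V| = kappa |grad H|] (enorm_hamiltonian); and
    substituting this in [W] gives its expression by the two norms. *)

(** * Functions of class C^n on an open subset of the plane *)

Section PlaneCalculus.
Context {R : realType}.
Implicit Types (A : set (R * R)) (f g : R * R -> R) (U V : R * R -> R * R).
Implicit Types (v z : R * R).

(** The Landau expansion of [f] at [a] is also one of [g], since it involves
    only values near [a]; so [g] has the differential of [f]. *)
Lemma near_eq_differentiable (X Y : normedModType R) (f g : X -> Y) (a : X) :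
  {near a, f =1 g} -> differentiable f a -> differentiable g a.
Proof.
move=> fg /diff_locallyP[df_cont /eqaddoP fE].
have gE : g \o shift a = cst (g a) + 'd f a +o_ 0 id.
  apply/eqaddoP => e e0; have := fE e e0; rewrite (nbhs_singleton fg).
  have : \forall h \near 0, f (h + a) = g (h + a).
    rewrite (near_shift a 0); move: fg; apply: filterS => y /=.
    by rewrite sub0r addrNK.
  apply: filterS2 => h fgh.
  by rewrite -![(_ + _ : _ -> _) _]/(_ + _) -![(- _ : _ -> _) _]/(- _) /= fgh.
have dgE : 'd g a = 'd f a :> (X -> Y) by exact: diff_unique.
by apply/diff_locallyP; rewrite dgE.
Qed.

Lemma open_eq_near (X : topologicalType) (Y : Type) (D : set X) (f g : X -> Y) x :
  open D -> {in D, f =1 g} -> D x -> {near x, f =1 g}.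
Proof.
move=> oD fg Dx; apply: filterS (open_nbhs_nbhs (conj oD Dx)) => y Dy.
by apply: fg; exact: mem_set.
Qed.

(** Differentiability and derivatives at a point of an open set are local, so
    [f] and [g] agree up to order [n] there.  This is what lets the formulas for
    derivatives, valid only on [A], be used in the inductions on [n] below. *)
Lemma Cn_eq {n A f g} : open A -> {in A, f =1 g} -> Cn n A f -> Cn n A g.
Proof.
move=> oA; elim: n f g => [|n IHn] f g fg /=.
  move=> fc z Az; rewrite /prop_for /continuous_at -(fg z (mem_set Az)).
  apply: cvg_trans (fc z Az); apply: near_eq_cvg; exact: open_eq_near fg Az.
case=> df dxf dyf; split.
- move=> z Az; apply: near_eq_differentiable (df z Az); exact: open_eq_near fg Az.
- apply: IHn dxf => z /set_mem Az; apply: near_eq_derive; exact: open_eq_near fg Az.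
- apply: IHn dyf => z /set_mem Az; apply: near_eq_derive; exact: open_eq_near fg Az.
Qed.

Lemma sub_Cn {n A B f} : B `<=` A -> Cn n A f -> Cn n B f.
Proof.
move=> BA; elim: n f => [|n IHn] f /=; first by move=> fc z /BA; exact: fc.
by case=> df dxf dyf; split; [move=> z /BA; exact: df | exact: IHn | exact: IHn].
Qed.

Lemma CnS_Cn {n A f} : Cn n.+1 A f -> Cn n A f.
Proof.
elim: n f => [|n IHn] f [df dxf dyf].
  by move=> z Az; apply: differentiable_continuous; exact: df.
by split; [exact: df | exact: IHn dxf | exact: IHn dyf].
Qed.

Lemma Cn_opp {n A f} : open A -> Cn n A f -> Cn n A (fun z => - f z).
Proof.
move=> oA; elim: n f => [|n IHn] f.
  by move=> fc z Az; apply: continuousN; exact: fc.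
move=> [df dxf dyf].
have dvE v : {in A, (fun z => - 'D_v f z) =1 'D_v (fun z => - f z)}.
  move=> z /set_mem Az; rewrite (_ : (fun z => - f z) = - f)//.
  by rewrite deriveN//; apply: diff_derivable; exact: df.
split.
- by move=> z Az; apply: differentiableN; exact: df.
- exact: (Cn_eq oA (dvE _) (IHn _ dxf)).
- exact: (Cn_eq oA (dvE _) (IHn _ dyf)).
Qed.

Lemma Cn_add {n A f g} : open A -> Cn n A f -> Cn n A g ->
  Cn n A (fun z => f z + g z).
Proof.
move=> oA; elim: n f g => [|n IHn] f g.
  by move=> fc gc z Az; apply: continuousD; [exact: fc | exact: gc].
move=> [df dxf dyf] [dg dxg dyg].
have dvE v : {in A, (fun z => 'D_v f z + 'D_v g z) =1
                    'D_v (fun z => f z + g z)}.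
  move=> z /set_mem Az; rewrite (_ : (fun z => f z + g z) = f + g)//.
  by rewrite deriveD//; apply: diff_derivable; [exact: df | exact: dg].
split.
- by move=> z Az; apply: differentiableD; [exact: df | exact: dg].
- exact: (Cn_eq oA (dvE _) (IHn _ _ dxf dxg)).
- exact: (Cn_eq oA (dvE _) (IHn _ _ dyf dyg)).
Qed.

Lemma derive_mul {f g z} v : differentiable f z -> differentiable g z ->
  'D_v (fun w => f w * g w) z = f z * 'D_v g z + g z * 'D_v f z.
Proof.
move=> df dg; rewrite (_ : (fun w => f w * g w) = f * g)//.
by rewrite deriveM//; exact: diff_derivable.
Qed.

Lemma derive_inv {f z} v : differentiable f z -> f z != 0 ->
  'D_v (fun w => (f w)^-1) z = - ((f z)^-1 * (f z)^-1 * 'D_v f z).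
Proof.
move=> df fz0; rewrite deriveV//; last exact: diff_derivable.
by rewrite /GRing.scale /= mulNr expr2 invfM.
Qed.

Lemma derive_div {f g z} v :
  differentiable f z -> differentiable g z -> g z != 0 ->
  'D_v (fun w => f w / g w) z =
  'D_v f z / g z - f z * 'D_v g z / g z ^+ 2.
Proof.
move=> df dg gz0; rewrite derive_mul// ?derive_inv//; last exact: differentiableV.
by field.
Qed.

Lemma Cn_mul {n A f g} : open A -> Cn n A f -> Cn n A g ->
  Cn n A (fun z => f z * g z).
Proof.
move=> oA; elim: n f g => [|n IHn] f g.
  by move=> fc gc z Az; apply: continuousM; [exact: fc | exact: gc].
move=> fC gC; have := fC; have := gC => -[dg dxg dyg] [df dxf dyf].
have dvE v : {in A, (fun z => f z * 'D_v g z + g z * 'D_v f z) =1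
                    'D_v (fun z => f z * g z)}.
  by move=> z /set_mem Az; rewrite derive_mul//; [exact: df | exact: dg].
split.
- by move=> z Az; apply: differentiableM; [exact: df | exact: dg].
- exact: Cn_eq oA (dvE _)
    (Cn_add oA (IHn _ _ (CnS_Cn fC) dxg) (IHn _ _ (CnS_Cn gC) dxf)).
- exact: Cn_eq oA (dvE _)
    (Cn_add oA (IHn _ _ (CnS_Cn fC) dyg) (IHn _ _ (CnS_Cn gC) dyf)).
Qed.

(** The derivatives of [1 / f] are polynomials in [1 / f] and the derivatives
    of [f]; so, for [f] of class C^(n+1), they are C^n as soon as [1 / f] is. *)
Lemma Cn_inv {n A f} : open A -> (forall z, A z -> f z != 0) ->
  Cn n A f -> Cn n A (fun z => (f z)^-1).
Proof.
move=> oA f0; elim: n => [|n IHn].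
  by move=> fc z Az; apply: continuousV; [exact: f0 | exact: fc].
move=> fC; have := fC => -[df dxf dyf].
have dvE v : {in A, (fun z => - ((f z)^-1 * (f z)^-1 * 'D_v f z)) =1
                    'D_v (fun z => (f z)^-1)}.
  by move=> z /set_mem Az; rewrite derive_inv//; [exact: df | exact: f0].
have sqC : Cn n A (fun z => (f z)^-1 * (f z)^-1).
  by apply: Cn_mul oA _ _; exact: IHn (CnS_Cn fC).
split.
- by move=> z Az; apply: differentiableV; [exact: df | exact: f0].
- exact: Cn_eq oA (dvE _) (Cn_opp oA (Cn_mul oA sqC dxf)).
- exact: Cn_eq oA (dvE _) (Cn_opp oA (Cn_mul oA sqC dyf)).
Qed.

Lemma derive_partials {f z} v : differentiable f z ->
  'D_v f z = v.1 * dx f z + v.2 * dy f z.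
Proof.
move=> df; rewrite /dx /dy !deriveE//.
have {1}-> : v = v.1 *: ((1, 0) : R * R) + v.2 *: ((0, 1) : R * R).
  case: v => a b; congr pair => /=.
    by rewrite /GRing.scale /= mulr1 mulr0 addr0.
  by rewrite /GRing.scale /= mulr1 mulr0 add0r.
by rewrite linearD !linearZ.
Qed.

Lemma derive_pair {f g z} v : differentiable f z -> differentiable g z ->
  'D_v (fun w => (f w, g w)) z = ('D_v f z, 'D_v g z).
Proof.
move=> df dg; rewrite !deriveE// ?diff_pair//.
exact: differentiable_pair.
Qed.

End PlaneCalculus.

(** * The bracket of V with the rescaled rotated field *)

(** The divergence of [V / kappa] is
    [(kappa * div V - D_V kappa) / kappa ^ 2]. *)
Lemma derive_reciprocal_integrating_factor {R : realType} {A : set (R * R)}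
    {V : R * R -> R * R} {kappa : R * R -> R} :
  CnV 1 A V -> reciprocal_integrating_factor A V kappa ->
  forall z, A z -> 'D_(V z) kappa z = kappa z * divergence V z.
Proof.
move=> [[dP _ _] [dQ _ _]] [[dk _ _] k_gt0 [_ _ div0]] z Az.
have k0 : kappa z != 0 by rewrite gt_eqF// k_gt0.
have dkV : differentiable (fun w => (kappa w)^-1) z.
  by apply: differentiableV => //; exact: dk.
have := div0 z Az; rewrite /divergence /= /dx /dy.
rewrite !derive_mul//; [|exact: dQ|exact: dP].
rewrite !derive_inv//; [|exact: dk..].
rewrite (derive_partials (V z) (dk z Az)) /dx /dy.
set px := 'D_(1, 0) _ z; set qy := 'D_(0, 1) (fun w => (V w).2) z => h.
(* The final [0] stands for the divergence of [V / kappa], which [h] evaluates: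
   it makes the equation an identity of rational functions. *)
have -> : kappa z * (px + qy) =
    (V z).1 * 'D_(1, 0) kappa z + (V z).2 * 'D_(0, 1) kappa z + kappa z ^+ 2 * 0.
  by rewrite -[X in _ ^+ 2 * X]h; field.
by rewrite mulr0 addr0.
Qed.

Section Normalizer.
Context {R : realType} {A : set (R * R)} {P Q kappa : R * R -> R}.
Hypotheses (A_open : open A) (PC : Cn 1 A P) (QC : Cn 1 A Q)
  (kC : Cn 1 A kappa) (V0 : forall z, A z -> P z ^+ 2 + Q z ^+ 2 != 0).
Let V (z : R * R) := (P z, Q z).
Let N (z : R * R) := P z ^+ 2 + Q z ^+ 2.
Let W (z : R * R) :=
  (- (kappa z * (Q z / N z)), kappa z * (P z / N z)).

Lemma normsq_Cn : Cn 1 A N.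
Proof. exact: Cn_add A_open (Cn_mul A_open PC PC) (Cn_mul A_open QC QC). Qed.

Lemma normalizer_field_Cn : CnV 1 A W.
Proof.
have NVC : Cn 1 A (fun z => (N z)^-1) := Cn_inv A_open V0 normsq_Cn.
have quotC (f : R * R -> R) : Cn 1 A f -> Cn 1 A (fun z => kappa z * (f z / N z)).
  by move=> fC; exact: Cn_mul A_open kC (Cn_mul A_open fC NVC).
by split; [exact: Cn_opp A_open (quotC Q QC) | exact: quotC P PC].
Qed.

(** The derivatives of [kappa] enter the bracket only along [V].  That one is
    kept whole, so that the hypothesis eliminates it; all other derivatives are
    expanded in partial derivatives, and what remains is an identity of rational
    functions with denominators powers of [N]. *)
Lemma lie_bracket_normalizer_field z : A z ->
  'D_(V z) kappa z = kappa z * divergence V z ->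
  lie_bracket V W z =
  (kappa z *
    ((- P z ^+ 2 * (dx Q z + dy P z)
      + 2 * P z * Q z * (dx P z - dy Q z)
      + Q z ^+ 2 * (dx Q z + dy P z)) / N z ^+ 2)) *: V z.
Proof.
move=> Az dVk; have [dP _ _] := PC; have [dQ _ _] := QC; have [dk _ _] := kC.
have [dN _ _] := normsq_Cn.
have [[dW1 _ _] [dW2 _ _]] := normalizer_field_Cn.
have {}dP := dP z Az; have {}dQ := dQ z Az; have {}dk := dk z Az.
have {}dN := dN z Az; have {}dW1 := dW1 z Az; have {}dW2 := dW2 z Az.
have Nz0 : N z != 0 by exact: V0.
have dNE v : 'D_v N z = 2 * (P z * 'D_v P z + Q z * 'D_v Q z).
  rewrite /N (_ : (fun _ => _) = (P * P) + (Q * Q))//.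
  rewrite deriveD; [|by apply: diff_derivable; exact: differentiableM..].
  rewrite !derive_mul//; ring.
have dquot (f : R * R -> R) v : differentiable f z ->
    'D_v (fun w => kappa w * (f w / N w)) z =
    kappa z * ('D_v f z / N z - f z * 'D_v N z / N z ^+ 2)
    + f z / N z * 'D_v kappa z.
  move=> df; rewrite derive_mul// ?derive_div//.
  by apply: differentiableM => //; exact: differentiableV.
rewrite /lie_bracket derive_pair// derive_pair//.
rewrite (_ : (fun w => - (kappa w * (Q w / N w)))
           = - (fun w => kappa w * (Q w / N w)))//.
rewrite deriveN; last first.
  apply: diff_derivable; apply: differentiableM => //.
  by apply: differentiableM => //; exact: differentiableV.
rewrite !dquot// dNE dVk (derive_partials _ dP) (derive_partials _ dQ).
rewrite (derive_partials (W z) dP) (derive_partials (W z) dQ).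
rewrite /divergence /W /V /N /=; congr pair => /=; rewrite /GRing.scale /=;
  field; exact: Nz0.
Qed.

End Normalizer.

(** * The Euclidean norm *)

Section EuclideanNorm.
Context {R : realType}.
Implicit Types v : R * R.

Lemma sumsq_eq0 v : (v.1 ^+ 2 + v.2 ^+ 2 == 0) = (v == 0).
Proof.
case: v => a b /=; rewrite paddr_eq0 ?sqr_ge0// !sqrf_eq0.
by rewrite xpair_eqE.
Qed.

Lemma enorm_eq0 v : (enorm v == 0) = (v == 0).
Proof.
by rewrite /enorm sqrtr_eq0 -sumsq_eq0 eq_le andbC addr_ge0 ?sqr_ge0.
Qed.

Lemma sqr_enorm v : enorm v ^+ 2 = v.1 ^+ 2 + v.2 ^+ 2.
Proof. by rewrite sqr_sqrtr// addr_ge0 ?sqr_ge0. Qed.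

(** With [(a, b)] the gradient of a function, [(k * b, - k * a)] is the
    Hamiltonian field of that function, rescaled by [k]. *)
Lemma enorm_hamiltonian (k a b : R) : 0 <= k ->
  enorm (k * b, - k * a) = k * enorm (a, b).
Proof.
move=> k0; rewrite /enorm /= -[in RHS](ger0_norm k0) -sqrtr_sqr.
by rewrite -sqrtrM ?sqr_ge0//; congr Num.sqrt; ring.
Qed.

End EuclideanNorm.

(** * The normalizer attached to a reciprocal integrating factor *)

Theorem theorem1 (R : realType) (Omega : set (R * R)) (P Q kappa : R * R -> R)
    (Omega_open : open Omega) (Omega_connected : connected Omega) :
  let V : R * R -> R * R := fun z => (P z, Q z) in
  CnV 2 Omega V ->
  reciprocal_integrating_factor Omega V kappa ->
  let A : set (R * R) := [set z | Omega z /\ V z <> 0] in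
  let W : R * R -> R * R := fun z =>
    (- (kappa z * (Q z / (P z ^+ 2 + Q z ^+ 2))),
     kappa z * (P z / (P z ^+ 2 + Q z ^+ 2))) in
  [/\ open A,
      normalizer A V W,
      forall mu : R * R -> R,
        (forall z, A z -> lie_bracket V W z = mu z *: V z) <->
        (forall z, A z ->
          mu z = kappa z *
            ((- P z ^+ 2 * (dx Q z + dy P z)
              + 2 * P z * Q z * (dx P z - dy Q z)
              + Q z ^+ 2 * (dx Q z + dy P z))
             / (P z ^+ 2 + Q z ^+ 2) ^+ 2)) &
      forall (B : set (R * R)) (H : R * R -> R),
        open B -> B `<=` Omega ->
        first_integral Omega V B H ->
        (forall z, B z -> P z = kappa z * dy H z /\ Q z = - kappa z * dx H z) ->
        forall z, B z -> V z <> 0 ->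
          kappa z = enorm (V z) / enorm (grad H z) /\
          W z = (- (Q z / (enorm (V z) * enorm (grad H z))),
                 P z / (enorm (V z) * enorm (grad H z)))].
Proof.
move=> V VC2 kR A W.
have VC : CnV 1 Omega V by case: VC2 => P2 Q2; split; exact: CnS_Cn.
have [PC QC] := VC.
have N0 z : V z <> 0 -> P z ^+ 2 + Q z ^+ 2 != 0.
  by move/eqP; rewrite -(sumsq_eq0 (V z)).
have A_open : open A.
  rewrite openE => z [Oz /N0 Nz0].
  have N_cont : {for z, continuous (fun w => P w ^+ 2 + Q w ^+ 2)}.
    have [dN _ _] := normsq_Cn Omega_open PC QC.
    exact: differentiable_continuous (dN z Oz).
  have N_neq0 : \forall w \near z, P w ^+ 2 + Q w ^+ 2 != 0.
    exact: cvgr_neq0 N_cont Nz0.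
  apply: filterS2 (open_nbhs_nbhs (conj Omega_open Oz)) N_neq0 => w Ow.
  by rewrite (sumsq_eq0 (V w)) => /eqP.
have AO : A `<=` Omega by move=> z [].
have [kC k_gt0 _] := kR.
have bracketE z : A z -> lie_bracket V W z = _ :=
  fun Az => lie_bracket_normalizer_field A_open (sub_Cn AO PC) (sub_Cn AO QC)
    (sub_Cn AO kC) (fun w Aw => N0 w Aw.2) z Az
    (derive_reciprocal_integrating_factor VC kR z (AO z Az)).
split=> //.
- split; last by move=> z Az; rewrite bracketE// /wedge /V /= /GRing.scale /=; ring.
  by apply: normalizer_field_Cn => //;
    [exact: sub_Cn PC | exact: sub_Cn QC | exact: sub_Cn kC | move=> z [_ /N0]].
- move=> mu; split=> [muE z Az|muE z Az]; last by rewrite muE// bracketE.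
  have := muE z Az; rewrite bracketE// => /eqP.
  rewrite -subr_eq0 -scalerBl scaler_eq0 => /orP[|/eqP Vz0]; last first.
    by case: Az => _ /(_ Vz0).
  by rewrite subr_eq0 => /eqP <-.
- move=> B H B_open BO _ VE z Bz Vz0; have [PE QE] := VE z Bz.
  have k0 := k_gt0 z (BO z Bz).
  have VH : enorm (V z) = kappa z * enorm (grad H z).
    by rewrite /V PE QE enorm_hamiltonian// ltW.
  have : enorm (V z) != 0 by rewrite enorm_eq0; exact/eqP.
  rewrite VH mulf_eq0 negb_or => /andP[kz0 gH0].
  have NE : P z ^+ 2 + Q z ^+ 2 = (kappa z * enorm (grad H z)) ^+ 2.
    by rewrite -VH sqr_enorm.
  split; first by rewrite mulfK.
  rewrite /W NE; congr pair; field; by rewrite kz0 gH0.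
Qed.
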